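(* Let $X=(X,\|\cdot\|)$ be a real normed linear space and let $f:\mathbb{R}^{+}\to\mathbb{R}$ be a nonnegative function. Then the inequalities $$f(\|x\|)\|x\|+f(\|y\|)\|y\|-\left(\|x\|+\|y\|-\|x-y\|\right)\max\{f(\|x\|),f(\|y\|)\}\leq \left\|f(\|x\|)x-f(\|y\|)y\right\|$$ and $$\left\|f(\|x\|)x-f(\|y\|)y\right\|\leq f(\|x\|)\|x\|+f(\|y\|)\|y\|-\left(\|x\|+\|y\|-\|x-y\|\right)\min\{f(\|x\|),f(\|y\|)\}$$ hold for all nonzero vectors $x,y\in X$.
   Context: $\mathbb{R}^{+}$ denotes the set of positive real numbers. *)

(* Defs.v *)
From mathcomp Require Export all_boot all_order all_algebra.
From mathcomp Require Export reals normedtype.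
Export numFieldNormedType.Exports.

(* Main.v *)
Require Import Defs.
From mathcomp Require Import ring.
Import Order.TTheory GRing.Theory Num.Theory.
Local Open Scope ring_scope.

(** Write [a = f `|x|] and [b = f `|y|], two nonnegative scalars.
    When [a <= b], the vector [a *: x - b *: y] can be compared with a multiple
    of [x - y] in two ways, correcting one coefficient at a time:
      [a *: x - b *: y = a *: (x - y) - (b - a) *: y]
                      [= b *: (x - y) - (b - a) *: x].
    The triangle inequality on the first form gives the bound with the minimum
    [a], and the reverse triangle inequality on the second gives the bound with
    the maximum [b]: see [norm_scale_sub_le] and [norm_scale_sub_ge].  The case
    [b <= a] follows by exchanging the two vectors. *)

(** Scaling both vectors by the smaller coefficient [a] leaves the error
    [(b - a) *: y], which costs at most its norm. *)
Lemma norm_scale_sub_le (R : numFieldType) (X : normedModType R) (a b : R)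
    (x y : X) : 0 <= a -> a <= b ->
  `|a *: x - b *: y| <= a * `|x| + b * `|y| - (`|x| + `|y| - `|x - y|) * a.
Proof.
move=> a_ge0 le_ab.
have -> : a *: x - b *: y = a *: (x - y) - (b - a) *: y.
  by rewrite scalerBr scalerBl opprB addrA subrK.
apply: le_trans (ler_normB _ _) _.
rewrite !normrZ (ger0_norm a_ge0) ger0_norm ?subr_ge0 //.
by rewrite le_eqVlt; apply/predU1P; left; ring.
Qed.

(** Scaling both vectors by the larger coefficient [b] leaves the error
    [(b - a) *: x], which the reverse triangle inequality subtracts. *)
Lemma norm_scale_sub_ge (R : numFieldType) (X : normedModType R) (a b : R)
    (x y : X) : 0 <= b -> a <= b ->
  a * `|x| + b * `|y| - (`|x| + `|y| - `|x - y|) * b <= `|a *: x - b *: y|.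
Proof.
move=> b_ge0 le_ab.
have -> : a *: x - b *: y = b *: (x - y) - (b - a) *: x.
  by rewrite scalerBr scalerBl opprB [RHS]addrC addrA subrK.
apply: le_trans (lerB_dist _ _).
rewrite !normrZ (ger0_norm b_ge0) ger0_norm ?subr_ge0 //.
by rewrite le_eqVlt; apply/predU1P; left; ring.
Qed.

Theorem theorem1 (R : realType) (X : normedModType R) (f : R -> R)
    (f_ge0 : forall t : R, 0 < t -> 0 <= f t) (x y : X)
    (x_neq0 : x != 0) (y_neq0 : y != 0) :
  f `|x| * `|x| + f `|y| * `|y|
    - (`|x| + `|y| - `|x - y|) * Num.max (f `|x|) (f `|y|)
    <= `|f `|x| *: x - f `|y| *: y|
  /\
  `|f `|x| *: x - f `|y| *: y|
    <= f `|x| * `|x| + f `|y| * `|y|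
       - (`|x| + `|y| - `|x - y|) * Num.min (f `|x|) (f `|y|).
Proof.
have fx_ge0 : 0 <= f `|x| by apply: f_ge0; rewrite normr_gt0.
have fy_ge0 : 0 <= f `|y| by apply: f_ge0; rewrite normr_gt0.
have [le_xy|/ltW le_yx] := leP (f `|x|) (f `|y|).
  by split; [exact: norm_scale_sub_ge | exact: norm_scale_sub_le].
rewrite (distrC x y) (distrC (f `|x| *: x)) (addrC (_ * `|x|)) (addrC `|x|).
by split; [exact: norm_scale_sub_ge | exact: norm_scale_sub_le].
Qed.
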